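(* Let $n\ge 2$ and let $x$ be an indeterminate. Let $C$ be the $n\times n$ tridiagonal matrix with all diagonal entries equal to $x$, all entries immediately above and below the diagonal equal to $1$, and all other entries $0$. Let $E$ be the $n\times n$ skew-symmetric matrix with $E_{1n}=1$, $E_{n1}=-1$, and all other entries $0$. Let $\Omega$ be the $2n\times 2n$ skew-symmetric matrix $$\Omega=\begin{pmatrix} E & C\\ -C & E\end{pmatrix}.$$ Then the Chebyshev polynomial of the first kind $T_n$ satisfies $$T_n\left(\tfrac{x}{2}\right)=\tfrac12\,R_n(x,\dots,x)=\tfrac12\,\mathrm{pf}(\Omega),$$ where $R_n$ is the rotundus polynomial and the last equality means that $R_n(x,\dots,x)$ is a Pfaffian of $\Omega$ in the sense that $\det(\Omega)=R_n(x,\dots,x)^2$.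
   Context: The Chebyshev polynomials of the first kind are defined by $T_0(x)=1$, $T_1(x)=x$, and $T_{n+1}(x)=2xT_n(x)-T_{n-1}(x)$. The continuant $K_n(a_1,\dots,a_n)$ is the determinant of the $n\times n$ tridiagonal matrix with diagonal entries $a_1,\dots,a_n$, all entries immediately above and below the diagonal equal to $1$, and all other entries $0$; by convention $K_0=1$. The rotundus is the polynomial $R_n(a_1,\dots,a_n):=K_n(a_1,\dots,a_n)-K_{n-2}(a_2,\dots,a_{n-1})$. The Pfaffian $\mathrm{pf}(\Omega)$ of a skew-symmetric matrix $\Omega$ is understood here through $\det(\Omega)=\mathrm{pf}(\Omega)^2$, i.e. only up to an overall sign. *)

(* Defs.v *)
From mathcomp Require Import all_boot all_order all_algebra.

Set Implicit Arguments.
Unset Strict Implicit.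
Unset Printing Implicit Defensive.

Import GRing.Theory.
Local Open Scope ring_scope.

Fixpoint chebyshevT (R : comNzRingType) (n : nat) : {poly R} :=
  match n with
  | 0 => 1
  | 1 => 'X
  | (m.+1 as k).+1 => 2%:R * 'X * chebyshevT R k - chebyshevT R m
  end.

(* Sequences a_1, ..., a_n are given by functions a : nat -> R shifted to
   start at 0: a_(i+1) is [a i], and only the values [a i] with i < n matter. *)

Definition tridiag_mx (R : comNzRingType) (n : nat) (a : nat -> R) : 'M[R]_n :=
  \matrix_(i < n, j < n)
    if i == j then a i
    else if (i.+1 == j :> nat) || (j.+1 == i :> nat) then 1 else 0.

(* For n = 0 this is the determinant of the empty matrix, so K_0 = 1. *)
Definition continuant (R : comNzRingType) (n : nat) (a : nat -> R) : R :=
  \det (tridiag_mx n a).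

(* K_n(a_1, ..., a_n) - K_(n-2)(a_2, ..., a_(n-1)). The subtraction [n - 2] is
   truncated, so the definition is meaningful only for 2 <= n. *)
Definition rotundus (R : comNzRingType) (n : nat) (a : nat -> R) : R :=
  continuant n a - continuant (n - 2) (fun i => a i.+1).

Definition corner_mx (R : comNzRingType) (n : nat) : 'M[R]_n :=
  \matrix_(i < n, j < n)
    if (i == 0 :> nat) && (j == n.-1 :> nat) then 1
    else if (i == n.-1 :> nat) && (j == 0 :> nat) then -1 else 0.

Definition Omega_mx (R : comNzRingType) (n : nat) (x : R) : 'M[R]_(n + n) :=
  let C := tridiag_mx n (fun _ => x) in
  let E := corner_mx R n in
  block_mx E C (- C) E.

(* Main.v *)
Require Import Defs.
From mathcomp Require Import all_boot all_order all_algebra.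
From mathcomp Require Import ring.

Set Implicit Arguments.
Unset Strict Implicit.
Unset Printing Implicit Defensive.

Import GRing.Theory.
Local Open Scope ring_scope.

(* The Chebyshev identity holds because both sides satisfy
   u_(n+2) = x u_(n+1) - u_n. For the determinant, work in a field where
   K_n = det C is nonzero. Taking a Schur complement,
   det Omega = (det C)^2 det(1 + (C^-1 E)^2). Since E = U J U^T has rank two,
   Sylvester's identity turns the last factor into the 2x2 determinant
   det(1 + (J M)^2) with M = U^T C^-1 U the symmetric matrix of corner entries
   of C^-1; as J M is traceless, (J M)^2 = - det M, and
   det Omega = (K_n - K_n det M)^2. Finally M has diagonal entries
   K_(n-1) / K_n and off-diagonal entries (-1)^(n-1) / K_n, so that
   K_n det M = (K_(n-1)^2 - 1) / K_n = K_(n-2). *)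

(** Laplace expansion along the first row, then along the first column of the second minor. *)
Lemma continuantSS (R : comNzRingType) n (a : nat -> R) :
  continuant n.+2 a =
    a 0%N * continuant n.+1 (fun i => a i.+1) - continuant n (fun i => a i.+2).
Proof.
rewrite /continuant (expand_det_row _ ord0) !big_ord_recl big1 ?addr0; last first.
  by move=> i _; rewrite !mxE /= mul0r.
rewrite !mxE /= mul1r /cofactor /= expr0 mul1r add0n expr1 mulN1r.
congr (_ * \det _ - _).
  by apply/matrixP => i j; rewrite !mxE.
rewrite (expand_det_col _ ord0) big_ord_recl big1 ?addr0; last first.
  by move=> i _; rewrite !mxE /= mul0r.
rewrite !mxE /= mul1r /cofactor /= expr0 mul1r.
by congr (\det _); apply/matrixP => i j; rewrite !mxE.
Qed.

Lemma continuant0 (R : comNzRingType) (a : nat -> R) : continuant 0 a = 1.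
Proof. exact: det_mx00. Qed.

Lemma continuant1 (R : comNzRingType) (a : nat -> R) : continuant 1 a = a 0%N.
Proof. by rewrite /continuant det_mx11 mxE. Qed.

(** By the recurrence the left side does not depend on [n]. This supplies
    [K_(n-1)^2 - 1 = K_n K_(n-2)]. *)
Lemma continuant_const_euler (R : comNzRingType) n (x : R) :
  continuant n.+1 (fun=> x) ^+ 2
    - continuant n.+2 (fun=> x) * continuant n (fun=> x) = 1.
Proof.
elim: n => [|n IHn].
  by rewrite continuantSS continuant1 continuant0; ring.
rewrite -[RHS]IHn (continuantSS n.+1) (continuantSS n); ring.
Qed.

Lemma tridiag_mx_tr (R : comNzRingType) n (a : nat -> R) :
  (tridiag_mx n a)^T = tridiag_mx n a.
Proof.
by apply/matrixP => i j; rewrite !mxE [j == i]eq_sym orbC; case: eqP => // ->.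
Qed.

Lemma cofactor_tridiag00 (R : comNzRingType) n (a : nat -> R) :
  cofactor (tridiag_mx n.+1 a) ord0 ord0 = continuant n (fun i => a i.+1).
Proof.
rewrite /cofactor /= expr0 mul1r; congr (\det _).
by apply/matrixP => i j; rewrite !mxE.
Qed.

Lemma cofactor_tridiag_max (R : comNzRingType) n (a : nat -> R) :
  cofactor (tridiag_mx n.+1 a) ord_max ord_max = continuant n a.
Proof.
rewrite /cofactor /= addnn -signr_odd odd_double expr0 mul1r; congr (\det _).
apply/matrixP => i j; rewrite !mxE (inj_eq lift_inj).
by rewrite !(lift_max i) !(lift_max j).
Qed.

(** Deleting the last row and first column leaves a lower triangular matrix with unit diagonal, so
    only the sign survives. *)
Lemma cofactor_tridiag_corner (R : comNzRingType) n (a : nat -> R) :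
  cofactor (tridiag_mx n.+1 a) ord_max ord0 = (-1) ^+ n.
Proof.
have bumpn (i : 'I_n) : bump n i = i := lift_max i.
rewrite /cofactor /= addn0 det_trig ?big1 ?mulr1 // => [i _|].
  rewrite !mxE -val_eqE /= bumpn.
  by rewrite /bump add1n ltn_eqF // eqxx.
apply/is_trig_mxP => i j lt_ij; rewrite !mxE -val_eqE /= bumpn /bump add1n eqSS.
by rewrite (ltn_eqF lt_ij) ltn_eqF ?gtn_eqF // ?ltnS ltnW // ltnW.
Qed.

Lemma cofactor_tr (R : comNzRingType) n (A : 'M[R]_n) i j :
  cofactor A^T i j = cofactor A j i.
Proof.
rewrite /cofactor addnC -[in RHS]det_tr; congr (_ * \det _).
by apply/matrixP => k l; rewrite !mxE.
Qed.

(** Multiplying the same two block matrices in either order gives block triangular products with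
    equal determinants. *)
Lemma det_add1_mulmxC (R : comNzRingType) m n
    (X : 'M[R]_(m, n)) (Y : 'M[R]_(n, m)) :
  \det (1%:M + X *m Y) = \det (1%:M + Y *m X).
Proof.
have E1 : block_mx 1%:M (- X) Y 1%:M *m block_mx 1%:M X 0 1%:M
   = block_mx 1%:M 0 Y (1%:M + Y *m X).
  by rewrite mulmx_block !(mulmx1, mul1mx, mulmx0, addr0) subrr addrC.
have E2 : block_mx 1%:M X 0 1%:M *m block_mx 1%:M (- X) Y 1%:M
   = block_mx (1%:M + X *m Y) 0 Y 1%:M.
  by rewrite mulmx_block !(mulmx1, mul1mx, mul0mx, add0r) addNr.
move/(congr1 determinant): E1; move/(congr1 determinant): E2.
rewrite !det_mulmx !det_lblock !det_ublock !det1 !(mul1r, mulr1) => <-.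
by move=> <-.
Qed.

Lemma det_block_schur (k : fieldType) n (C E : 'M[k]_n) : C \in unitmx ->
  \det (block_mx E C (- C) E)
    = \det C ^+ 2 * \det (1%:M + invmx C *m E *m invmx C *m E).
Proof.
move=> uC.
(* This quarter turn moves the invertible [C] to the top left block; as a product of three
   transvections it has determinant 1. *)
have detJ : \det (block_mx 0 (- 1%:M) 1%:M 0 : 'M[k]_(n + n)) = 1.
  have -> : block_mx 0 (- 1%:M) 1%:M 0 = block_mx 1%:M (- 1%:M) 0 1%:M
     *m block_mx 1%:M 0 1%:M 1%:M *m block_mx 1%:M (- 1%:M) 0 1%:M :> 'M[k]_(n + n).
    rewrite !mulmx_block !(mulmx1, mul1mx, mul0mx, mulmx0, addr0, add0r) subrr.
    by rewrite mul0mx add0r addNr.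
  by rewrite !det_mulmx !det_lblock !det_ublock !det1 !mulr1.
(* The last factor is unipotent and clears the top right block [- E]. *)
have EQ : block_mx E C (- C) E *m block_mx 0 (- 1%:M) 1%:M 0
   *m block_mx 1%:M (invmx C *m E) 0 1%:M
   = block_mx C 0 E (C *m (1%:M + invmx C *m E *m invmx C *m E)).
  rewrite !mulmx_block !(mulmx1, mul1mx, mul0mx, mulmx0, addr0, add0r, mulmxN).
  rewrite mulKVmx // subrr opprK mulmxDr mulmx1 -!mulmxA mulKVmx //.
  by rewrite addrC.
have := congr1 determinant EQ.
rewrite !det_mulmx detJ det_ublock det_lblock !det1 !mulr1 det_mulmx => ->.
by rewrite expr2 mulrA.
Qed.

Definition ends_mx (R : comNzRingType) n : 'M[R]_(n.+1, 2) :=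
  \matrix_(i, j) (i == if j == 0 then ord0 else ord_max)%:R.

Definition sympl2 (R : comNzRingType) : 'M[R]_2 :=
  \matrix_(i, j) if (i == 0) && (j == 1) then 1
                 else if (i == 1) && (j == 0) then -1 else 0.

(** Size at least 2 keeps the two ends distinct; in size 1 the right side would vanish while the
    corner entry is 1. *)
Lemma corner_mxE (R : comNzRingType) n :
  corner_mx R n.+2 = ends_mx R n.+1 *m sympl2 R *m (ends_mx R n.+1)^T.
Proof.
apply/matrixP => i j.
rewrite !(mxE, big_ord_recl, big_ord0) /= -!val_eqE /=.
case: (i =P 0%N :> nat) => [->|_]; case: (i =P n.+1 :> nat) => [e|_] //;
  case: (j =P 0%N :> nat) => [->|_]; case: (j =P n.+1 :> nat) => [e'|_] //=;
  rewrite ?e ?e'; ring.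
Qed.

Lemma ends_mx_conj (R : comNzRingType) n (A : 'M[R]_n.+1) i j :
  ((ends_mx R n)^T *m A *m ends_mx R n) i j =
    A (if i == 0 then ord0 else ord_max) (if j == 0 then ord0 else ord_max).
Proof.
rewrite mxE (bigD1 (if j == 0 then ord0 else ord_max)) //= big1 ?addr0.
  rewrite mxE (bigD1 (if i == 0 then ord0 else ord_max)) //= big1 ?addr0.
    by rewrite !mxE !eqxx mul1r mulr1.
  by move=> l /negPf nl; rewrite !mxE nl mul0r.
by move=> l /negPf nl; rewrite [ends_mx _ _ l j]mxE nl mulr0.
Qed.

Lemma det_mx22 (R : comNzRingType) (M : 'M[R]_2) :
  \det M = M 0 0 * M 1 1 - M 0 1 * M 1 0.
Proof.
rewrite (expand_det_row _ 0) big_ord_recl big_ord1 /cofactor !det_mx11 !mxE /=.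
have -> : lift ord0 ord0 = 1 :> 'I_2 by apply/val_inj.
have -> : lift 1 (0 : 'I_1) = 0 :> 'I_2 by apply/val_inj.
by rewrite expr0 expr1 mul1r mulN1r mulrN.
Qed.

(** Symmetry makes [J M] traceless, so this is Cayley-Hamilton with [det J = 1]. *)
Lemma sympl2_sqr (R : comNzRingType) (M : 'M[R]_2) : M^T = M ->
  sympl2 R *m M *m sympl2 R *m M = (- \det M)%:M.
Proof.
move=> symM; have e : M 1 0 = M 0 1 by rewrite -[in LHS]symM mxE.
have l0 : lift ord0 (0 : 'I_1) = 1 :> 'I_2 by apply/val_inj.
have ord2 (i : 'I_2) : i = 0 \/ i = 1.
  by case: i => [[|[|i]] lti] //; [left|right]; apply/val_inj.
apply/matrixP => i j; rewrite det_mx22.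
rewrite !(mxE, big_ord_recl, big_ord0) /= ?l0 e.
by case: (ord2 i) => ->; case: (ord2 j) => -> /=; rewrite ?e; ring.
Qed.

Lemma det_Omega (k : fieldType) n (x : k) : continuant n.+2 (fun=> x) != 0 ->
  \det (Omega_mx n.+2 x) = rotundus n.+2 (fun=> x) ^+ 2.
Proof.
move=> K0; rewrite /Omega_mx; set C := tridiag_mx _ _.
have detC : \det C = continuant n.+2 (fun=> x) by [].
have uC : C \in unitmx by rewrite unitmxE detC unitfE.
have invCE i j : invmx C i j = (continuant n.+2 (fun=> x))^-1 * cofactor C j i.
  by rewrite /invmx uC !mxE detC.
rewrite det_block_schur // corner_mxE.
set U := ends_mx _ _; set J := sympl2 _; set D := invmx C.
pose M := U^T *m D *m U.
have symM : M^T = M.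
  by rewrite /M !trmx_mul trmxK /D trmx_inv tridiag_mx_tr mulmxA.
have -> : D *m (U *m J *m U^T) *m D *m (U *m J *m U^T)
   = (D *m U) *m (J *m M *m J *m U^T) by rewrite /M !mulmxA.
rewrite det_add1_mulmxC.
have -> : J *m M *m J *m U^T *m (D *m U) = J *m M *m J *m M.
  by rewrite /M !mulmxA.
(* A scalar 2x2 matrix has a square determinant; it remains to show
   [K_n (1 - det M) = K_n - K_(n-2)]. *)
rewrite sympl2_sqr // -raddfD det_scalar -exprMn; congr (_ ^+ 2).
have corner : cofactor C ord0 ord_max = (-1) ^+ n.+1.
  by rewrite -cofactor_tr tridiag_mx_tr cofactor_tridiag_corner.
rewrite det_mx22 !ends_mx_conj /= !invCE corner cofactor_tridiag_corner.
rewrite cofactor_tridiag00 cofactor_tridiag_max detC /rotundus subn2 /=.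
have sgn : (-1) ^+ n.+1 * (-1) ^+ n.+1 = 1 :> k by rewrite -expr2 sqrr_sign.
have := continuant_const_euler n x.
set K := continuant n.+2 _ in K0 *; set L := continuant n.+1 _.
move/eqP; rewrite subr_eq => /eqP EL.
(* Factoring out [K^-1 ^+ 2] isolates the squared sign, after which [EL] applies. *)
have -> : K^-1 * L * (K^-1 * L) - K^-1 * (-1) ^+ n.+1 * (K^-1 * (-1) ^+ n.+1)
   = K^-1 ^+ 2 * (L ^+ 2 - (-1) ^+ n.+1 * (-1) ^+ n.+1) by ring.
rewrite sgn EL; by field.
Qed.

(** The continuant is the characteristic polynomial of a negated path adjacency matrix, hence
    monic. *)
Lemma continuantX_neq0 (F : fieldType) n : continuant n (fun=> 'X : {poly F}) != 0.
Proof.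
apply: monic_neq0.
suff -> : continuant n (fun=> 'X) = char_poly (- tridiag_mx n (fun=> 0 : F)).
  exact: char_poly_monic.
congr (\det _); apply/matrixP => i j; rewrite !mxE.
by case: eqP => _; [|case: ifP => _];
  rewrite ?mulr1n ?mulr0n ?(polyCN, opprK, oppr0, addr0, add0r).
Qed.

Lemma map_tridiag_mx (R S : comNzRingType) (f : {rmorphism R -> S}) n (a : nat -> R) :
  map_mx f (tridiag_mx n a) = tridiag_mx n (f \o a).
Proof.
by apply/matrixP => i j; rewrite !mxE !(fun_if f) rmorph0 rmorph1.
Qed.

Lemma map_continuant (R S : comNzRingType) (f : {rmorphism R -> S}) n (a : nat -> R) :
  f (continuant n a) = continuant n (f \o a).
Proof. by rewrite -det_map_mx map_tridiag_mx. Qed.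

Lemma map_Omega_mx (R S : comNzRingType) (f : {rmorphism R -> S}) n (x : R) :
  map_mx f (Omega_mx n x) = Omega_mx n (f x).
Proof.
rewrite /Omega_mx map_block_mx map_mxN map_tridiag_mx.
suff -> : map_mx f (corner_mx R n) = corner_mx S n by [].
by apply/matrixP => i j; rewrite !mxE !(fun_if f) rmorphN rmorph0 rmorph1.
Qed.

Lemma chebyshevT_rotundus (F : fieldType) (two_neq0 : 2%:R != 0 :> F) n :
  chebyshevT F n.+2 \Po (2%:R^-1 *: 'X)
    = 2%:R^-1 *: rotundus n.+2 (fun _ => 'X : {poly F}).
Proof.
have half p : 2%:R^-1 *: p = (2%:R^-1)%:P * p :> {poly F} by rewrite mul_polyC.
have h2 : (2%:R^-1)%:P * 2%:R = 1 :> {poly F}.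
  by rewrite -polyC_natr -polyCM mulVf.
have rec m : chebyshevT F m.+2 \Po (2%:R^-1 *: 'X)
    = 'X * (chebyshevT F m.+1 \Po (2%:R^-1 *: 'X))
        - (chebyshevT F m \Po (2%:R^-1 *: 'X)).
  rewrite [chebyshevT F m.+2]/= comp_polyB !comp_polyM comp_polyX.
  rewrite -polyC_natr comp_polyC polyC_natr half.
  congr (_ * _ - _).
  by rewrite mulrA [2%:R * _]mulrC h2 mul1r.
have T1 : chebyshevT F 1 \Po (2%:R^-1 *: 'X) = 2%:R^-1 *: 'X.
  exact: comp_polyX.
have T0 : chebyshevT F 0 \Po (2%:R^-1 *: 'X) = (2%:R^-1)%:P * 2%:R.
  by rewrite h2 /= comp_polyC.
rewrite /rotundus (_ : n.+2 - 2 = n)%N ?subn2 // [RHS]half.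
(* [T_2] and [T_3] are unfolded down to [T_0] and [T_1]; from [T_4] on, both predecessors fall under
   the induction hypothesis. *)
elim/ltn_ind: n => -[|[|n]] IHn; rewrite rec.
- by rewrite T1 T0 half continuantSS continuant1 continuant0; ring.
- rewrite rec T1 T0 half !continuantSS continuant1 continuant0; ring.
- rewrite !IHn // (continuantSS n.+2) (continuantSS n) (continuantSS n.+1).
  by rewrite (continuantSS n); ring.
Qed.

Theorem mainTheorem4 (F : fieldType) (two_neq0 : 2%:R != 0 :> F)
    (n : nat) (n_ge2 : (2 <= n)%N) :
  chebyshevT F n \Po (2%:R^-1 *: 'X)
    = 2%:R^-1 *: rotundus n (fun _ => 'X : {poly F})
  /\ \det (Omega_mx n ('X : {poly F}))
    = rotundus n (fun _ => 'X : {poly F}) ^+ 2.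
Proof.
case: n n_ge2 => [|[|n]] // _; split; first exact: chebyshevT_rotundus.
(* [{poly F}] embeds in its fraction field, where the nonzero continuant is invertible. *)
apply/eqP; rewrite -tofrac_eq; apply/eqP.
rewrite -det_map_mx map_Omega_mx det_Omega; last first.
  have := continuantX_neq0 F n.+2.
  by rewrite -tofrac_eq0 map_continuant.
by rewrite rmorphXn rmorphB /= !map_continuant.
Qed.
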